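(* Let $m\ge 2$ be an integer. The word growth series $\Delta_{S_{J_m}}(X)=\sum_{n\ge 0}\delta_{S_{J_m}}(n)X^n$ of $S_{J_m}$ is given by $$\Delta_{S_{J_m}}(X)=\frac{1}{1-X}\left(1+\frac{X}{1-X}\left(1+\frac{X^m}{1-X^m}\left(1+\frac{X^{m^2}}{1-X^{m^2}}\left(1+\frac{X^{m^3}}{1-X^{m^3}}\left(1+\frac{X^{m^4}}{1-X^{m^4}}\left(1+\cdots\right)\right)\right)\right)\right)\right).$$
   Context: Let $X_m=\{x_0,\ldots,x_{m-1}\}$ and let $X_m^\omega$ be the set of right-infinite words over $X_m$. $J_m$ is the Mealy automaton over $X_m$ with three states $e,f_0,f_1$, which define the following transformations of $X_m^\omega$ (for all $w\in X_m^\omega$): $e$ is the identity; $f_0(x_i w)=x_0 w$ for $0\le i\le m-2$ and $f_0(x_{m-1}w)=x_0 f_0(w)$; $f_1(x_i w)=x_{i+1}w$ for $0\le i\le m-2$ and $f_1(x_{m-1}w)=x_0 f_1(w)$. $S_{J_m}$ is the semigroup of transformations of $X_m^\omega$ generated by $e,f_0,f_1$ under composition; it is a monoid with identity $e$. Length is taken relative to the generators $\{e,f_0,f_1\}$: $\ell(e)=0$, and for $s\ne e$, $\ell(s)$ is the least $l$ such that $s$ is a product of $l$ generators. The word growth function is $\delta_{S_{J_m}}(n)=|\{s\in S_{J_m}:\ell(s)=n\}|$. The nested expression is a formal power series; with the outer factor removed it means $1+\sum_{k\ge 0}\prod_{i=0}^{k}\frac{X^{m^i}}{1-X^{m^i}}$.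 *)

(* Defs.v *)
From HB Require Import structures.
From mathcomp Require Import all_boot all_order all_algebra finmap.
From mathcomp Require Import all_classical.

Set Implicit Arguments.
Unset Strict Implicit.
Unset Printing Implicit Defensive.

Import GRing.Theory.

(* No topology and no radius of convergence: a series is its sequence of
   coefficients, multiplied by the Cauchy product. *)
Record fps (R : Type) := Fps { coefs : nat -> R }.

Lemma fpsP (R : Type) (f g : fps R) : coefs f =1 coefs g -> f = g.
Proof. by case: f g => [f] [g] /= /funext ->. Qed.

HB.instance Definition _ (R : Type) := gen_eqMixin (fps R).
HB.instance Definition _ (R : Type) := gen_choiceMixin (fps R).

Section FpsRing.
Local Open Scope ring_scope.
Variable R : comUnitRingType.
Implicit Types f g h : fps R.

Definition fps0 : fps R := Fps (fun=> 0).
Definition fps1 : fps R := Fps (fun n => (n == 0%N)%:R).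
Definition fpsD f g : fps R := Fps (fun n => coefs f n + coefs g n).
Definition fpsN f : fps R := Fps (fun n => - coefs f n).
Definition fpsM f g : fps R :=
  Fps (fun n => \sum_(j < n.+1) coefs f j * coefs g (n - j)%N).

Lemma fpsDA : associative fpsD.
Proof. by move=> f g h; apply: fpsP => n /=; rewrite addrA. Qed.
Lemma fpsDC : commutative fpsD.
Proof. by move=> f g; apply: fpsP => n /=; rewrite addrC. Qed.
Lemma fps0D : left_id fps0 fpsD.
Proof. by move=> f; apply: fpsP => n /=; rewrite add0r. Qed.
Lemma fpsND : left_inverse fps0 fpsN fpsD.
Proof. by move=> f; apply: fpsP => n /=; rewrite addNr. Qed.

HB.instance Definition _ := GRing.isZmodule.Build (fps R) fpsDA fpsDC fps0D fpsND.

Definition fps_trunc n f : {poly R} := \poly_(i < n) coefs f i.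

Lemma coef_fps_trunc n f k : (k < n)%N -> (fps_trunc n f)`_k = coefs f k.
Proof. by rewrite coef_poly => ->. Qed.

Lemma coefs_fpsM n f g k : (k < n)%N ->
  coefs (fpsM f g) k = (fps_trunc n f * fps_trunc n g)`_k.
Proof.
move=> kn; rewrite coefM /=; apply: eq_bigr => j _.
rewrite !coef_fps_trunc //; first exact: leq_ltn_trans (leq_subr _ _) kn.
by apply: leq_trans kn; apply: ltn_ord.
Qed.

Lemma fpsMA : associative fpsM.
Proof.
move=> f g h; apply: fpsP => k.
pose t := fps_trunc k.+1.
have El : coefs (fpsM f (fpsM g h)) k = (t f * (t g * t h))`_k.
  rewrite coefM /=; apply: eq_bigr => j _.
  have jk : (k - j < k.+1)%N by rewrite ltnS leq_subr.
  by rewrite -(coefs_fpsM g h jk) coef_fps_trunc.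
have Er : coefs (fpsM (fpsM f g) h) k = (t f * t g * t h)`_k.
  rewrite coefM /=; apply: eq_bigr => j _.
  by rewrite -(coefs_fpsM f g (ltn_ord j)) coef_fps_trunc // ltnS leq_subr.
by rewrite El Er mulrA.
Qed.

Lemma fpsMC : commutative fpsM.
Proof.
by move=> f g; apply: fpsP => k; rewrite !(coefs_fpsM _ _ (ltnSn k)) mulrC.
Qed.

Lemma fps1M : left_id fps1 fpsM.
Proof.
move=> f; apply: fpsP => k /=.
by rewrite big_ord_recl /= mul1r subn0 big1 ?addr0 // => j _; rewrite mul0r.
Qed.

Lemma fpsMDl : left_distributive fpsM fpsD.
Proof.
move=> f g h; apply: fpsP => k /=.
by rewrite -big_split /=; apply: eq_bigr => j _; rewrite mulrDl.
Qed.

Lemma fps1_neq0 : fps1 != 0 :> fps R.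
Proof.
by apply/eqP => /(congr1 (fun f => coefs f 0%N)) /= /eqP; rewrite oner_eq0.
Qed.

HB.instance Definition _ := GRing.Zmodule_isComNzRing.Build (fps R)
  fpsMA fpsMC fps1M fpsMDl fps1_neq0.

(* The first n coefficients of the inverse of f. *)
Fixpoint fps_invs f n : seq R :=
  if n is k.+1 then
    rcons (fps_invs f k)
      ((coefs f 0%N)^-1 *
       ((k == 0%N)%:R - \sum_(j < k) coefs f (k - j)%N * (fps_invs f k)`_j))
  else [::].

Definition fps_unit : {pred fps R} := fun f => coefs f 0%N \is a GRing.unit.

Definition fps_inv f : fps R :=
  if f \in fps_unit then Fps (fun n => (fps_invs f n.+1)`_n) else f.

Lemma size_fps_invs f n : size (fps_invs f n) = n.
Proof. by elim: n => //= n IH; rewrite size_rcons IH. Qed.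

Lemma nth_fps_invs f n j : (j < n)%N ->
  (fps_invs f n)`_j = (fps_invs f j.+1)`_j.
Proof.
elim: n => // n IH; rewrite ltnS leq_eqVlt => /predU1P[-> //|jn].
by rewrite [in LHS]/= nth_rcons size_fps_invs jn IH.
Qed.

Lemma fpsVM : {in fps_unit, left_inverse 1 fps_inv *%R}.
Proof.
move=> f fu; apply: fpsP => k; rewrite /fps_inv fu.
rewrite mulrC [coefs _ k](_ : _ =
  \sum_(j < k.+1) coefs f j * (fps_invs f (k - j).+1)`_(k - j)) //.
rewrite (reindex_inj rev_ord_inj) /= big_ord_recr /=.
rewrite subSS subnn subn0 nth_rcons size_fps_invs ltnn eqxx.
rewrite mulrA mulrV // mul1r.
rewrite (eq_bigr (fun j : 'I_k => coefs f (k - j) * (fps_invs f k)`_j)).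
  by rewrite addrC subrK.
move=> j _; rewrite subSS subKn; last exact: ltnW.
by rewrite (nth_fps_invs f (ltn_ord j)).
Qed.

Lemma fps_unitP f g : g * f = 1 -> f \in fps_unit.
Proof.
move=> /(congr1 (fun f => coefs f 0%N)) /=; rewrite big_ord1 => gf.
by apply/unitrPr; exists (coefs g 0%N); rewrite mulrC.
Qed.

Lemma fps_inv_out : {in [predC fps_unit], fps_inv =1 id}.
Proof. by move=> f; rewrite inE /fps_inv => /negPf ->. Qed.

HB.instance Definition _ := GRing.ComNzRing_hasMulInverse.Build (fps R)
  fpsVM fps_unitP fps_inv_out.

Definition fpsX : fps R := Fps (fun n => (n == 1%N)%:R).

(* Infinite sums converge in the X-adic sense: each coefficient of the partial
   sums is eventually constant. *)
Definition fps_has_sum (u : nat -> fps R) (s : fps R) : Prop :=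
  forall n, exists K, forall k, (K <= k)%N ->
    coefs (\sum_(i < k) u i) n = coefs s n.

End FpsRing.

Arguments fpsX {R}.

Record mealy (X : Type) := Mealy {
  mstate : Type;
  mtrans : mstate -> X -> mstate;
  mout : mstate -> X -> X }.

Definition word (X : Type) := nat -> X.

Definition wcons (X : Type) (x : X) (w : word X) : word X :=
  fun n => if n is k.+1 then w k else x.

Section Mealy.
Variables (X : Type) (A : mealy X).

(* The state reached from q after reading the first n letters of w. *)
Fixpoint mrun (q : mstate A) (w : word X) (n : nat) : mstate A :=
  if n is k.+1 then mtrans (mrun q w k) (w k) else q.

Definition mact (q : mstate A) (w : word X) : word X :=
  fun n => mout (mrun q w n) (w n).

Lemma mact_cons q x w :
  mact q (wcons x w) = wcons (mout q x) (mact (mtrans q x) w).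
Proof.
have E n : mrun q (wcons x w) n.+1 = mrun (mtrans q x) w n.
  by elim: n => //= n ->.
by apply/funext => -[|n] //; rewrite /mact E.
Qed.

Local Open Scope classical_set_scope.

Definition msemigroup : set (word X -> word X) :=
  smallest [set S : set (word X -> word X) |
            forall s t, S s -> S t -> S (s \o t)] (range mact).

Definition mprod (qs : seq (mstate A)) : word X -> word X :=
  foldr (fun q s => mact q \o s) id qs.

Definition is_mproduct (l : nat) (s : word X -> word X) : Prop :=
  exists2 qs : seq (mstate A), size qs = l & s = mprod qs.

(* The default value 0 of xget is never used on msemigroup (see mlengthP). The
   empty product is allowed, so that the identity has length 0 (mlength_id); it
   does not affect any other transformation. *)
Definition mlength (s : word X -> word X) : nat :=
  xget 0 [set l | is_mproduct l s /\ forall k, is_mproduct k s -> l <= k].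

Definition msphere (n : nat) : set (word X -> word X) :=
  [set s | msemigroup s /\ mlength s = n].

(* fset_set is faithful on finite sets only; see finite_msphere. *)
Definition mgrowth (n : nat) : nat :=
  #|` fset_set (msphere n : set {classic (word X -> word X)})|.

Definition mgrowth_series : fps int := Fps (fun n => (mgrowth n)%:Z%R).

Lemma mprod_cat qs rs : mprod (qs ++ rs) = mprod qs \o mprod rs.
Proof. by elim: qs => //= q qs ->. Qed.

Lemma msemigroup_mproduct s : msemigroup s -> exists l, is_mproduct l s.
Proof.
move=> /(_ [set s | exists l, is_mproduct l s]); apply; split.
  move=> _ _ [_ [qs _ ->]] [_ [rs _ ->]].
  by exists (size (qs ++ rs)), (qs ++ rs); rewrite ?mprod_cat.
by move=> _ [q _ <-]; exists 1, [:: q].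
Qed.

Lemma mlengthP s : msemigroup s ->
  is_mproduct (mlength s) s /\ forall k, is_mproduct k s -> mlength s <= k.
Proof.
move=> /msemigroup_mproduct [l sl]; rewrite /mlength; case: xgetP => // noL.
have exL : exists l, `[< is_mproduct l s >] by exists l; apply/asboolP.
case: (ex_minnP exL) => k /asboolP sk kmin; case: (noL k); split=> // j sj.
exact/kmin/asboolP.
Qed.

Lemma mlength_id : mlength id = 0.
Proof.
rewrite /mlength; case: xgetP => // l _ [_ /(_ 0)]; rewrite leqn0 => l0.
by apply/eqP/l0; exists [::].
Qed.

End Mealy.

Lemma finite_msphere (X : Type) (A : mealy X) (n : nat) :
  finite_set [set: mstate A] -> finite_set (msphere A n).
Proof.
move=> finA; suff fin l : finite_set [set s | is_mproduct A l s].
  by apply: sub_finite_set (fin n) => s [/mlengthP[+ _] <-].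
elim: l => [|l IH].
  by apply: sub_finite_set (finite_set1 id) => _ [[|//] _ ->].
have := finite_image2 (fun (q : mstate A) s => mact q \o s) finA IH.
apply: sub_finite_set => _ [[//|q qs] [] szl ->].
by exists q => //; exists (mprod qs) => //; exists qs.
Qed.

Inductive Jstate := Je | Jf0 | Jf1.

Section J.
Local Open Scope classical_set_scope.
Variable m : nat.

Definition ord_first (i : 'I_m) : 'I_m :=
  Ordinal (leq_ltn_trans (leq0n i) (ltn_ord i)).

Definition Jtrans (q : Jstate) (i : 'I_m) : Jstate :=
  if i.+1 == m then q else Je.

(* ordS is the cyclic successor i |-> i + 1 mod m. *)
Definition Jout (q : Jstate) (i : 'I_m) : 'I_m :=
  match q with Je => i | Jf0 => ord_first i | Jf1 => ordS i end.

Definition J : mealy 'I_m := Mealy Jtrans Jout.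

Lemma finite_Jstate : finite_set [set: mstate J].
Proof.
have <- : [set Je; Jf0; Jf1] = [set: Jstate]; last first.
  by rewrite 2!finite_setU; do ?split; apply: finite_set1.
by apply/seteqP; split=> // -[] _; [left; left|left; right|right].
Qed.

Lemma Je_id : mact (Je : mstate J) = id.
Proof.
have E w n : mrun (Je : mstate J) w n = Je.
  by elim: n => //= n ->; rewrite /Jtrans if_same.
by apply/funext => w; apply/funext => n; rewrite /mact E.
Qed.

Lemma Jf0_cons i w : mact (Jf0 : mstate J) (wcons i w) =
  wcons (ord_first i) (if i.+1 == m then mact (Jf0 : mstate J) w else w).
Proof. by rewrite mact_cons /= /Jtrans; case: ifP; rewrite ?Je_id. Qed.

Lemma Jf1_cons i w : mact (Jf1 : mstate J) (wcons i w) =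
  wcons (ordS i) (if i.+1 == m then mact (Jf1 : mstate J) w else w).
Proof. by rewrite mact_cons /= /Jtrans; case: ifP; rewrite ?Je_id. Qed.

End J.

(* Main.v *)
Require Import Defs.
From mathcomp Require Import all_boot all_order all_algebra finmap.
From mathcomp Require Import all_classical.

Set Implicit Arguments.
Unset Strict Implicit.
Unset Printing Implicit Defensive.

Import GRing.Theory.

(** Read a word as an [m]-adic integer, first letter least significant.  Then
    [f1] adds one, and [f0] adds one and then erases the lowest nonzero digit of
    the result (for the word whose letters are all [m - 1] it returns zero).  In
    particular [f0] is an idempotent whose range is the set of words starting
    with the letter 0, while [f1] is bijective.

    Both generators reproduce themselves one level down: on words [0w], the
    products [f1 ^ m] and [f0 f1 ^ (m-1)] act as [f1] and [f0] on [w], and every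
    product of generators sends [0w] to [j u(w)] for some letter [j] and some
    [u] in the semigroup ([mprod_letter0], [mprod_lift]).  Hence the elements of
    the semigroup fall into three disjoint classes: the identity, the elements
    [s f1], and the elements [s f0], the last ones being the maps
    [graft j u : w |-> j u(tail (f0 w))], with [j] and [u] uniquely determined.
    The point is disjointness: [s f0] is unchanged by [f0] on the right,
    whereas [s f1] never is ([comp_f1_not_f0_invariant]); that lemma goes by
    descent on the length of a product for [s], restricting to words that
    start with the letter [m - 1].  The same separation shows that the obvious
    products are shortest: [s f1] has length [l(s) + 1] and [graft j u] has
    length [j + m l(u) + 1].

    Since [j < m], the equation [n = j + m l(u)] determines [j] and [l(u)] as
    remainder and quotient, so the sphere of radius [n + 1] is the disjoint
    union of copies of the spheres of radii [n] and [n %/ m].  The growth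
    function [d] thus satisfies [d 0 = 1] and [d (n+1) = d n + d (n %/ m)].

    For the series [D] of [d] and [A = (1 - X) D], this recurrence reads
    [A(X) = 1 + X / (1 - X) A(X^m)] ([growth_functional]).  Substituting [X^m],
    [X^(m^2)] and so on into it and inserting each identity into the preceding
    one produces the nested expression; the remainder after [k] terms is
    divisible by [X^(k+1)] and so tends to zero ([functional_has_sum]). *)

(** * Words and products of states *)

Section Words.
Variable X : Type.

Definition wtail (w : word X) : word X := fun n => w n.+1.

Lemma wconsK x : cancel (wcons x) wtail.
Proof. by move=> w; apply/funext. Qed.

Lemma wcons_eta (w : word X) : wcons (w 0) (wtail w) = w.
Proof. by apply/funext => -[]. Qed.

Lemma wcons_inj x y (v w : word X) : wcons x v = wcons y w -> x = y /\ v = w.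
Proof.
move=> E; split; last by rewrite -(wconsK x v) E wconsK.
by have := congr1 (fun w : word X => w 0) E.
Qed.

End Words.

Section Products.
Local Open Scope classical_set_scope.
Variables (X : Type) (A : mealy X).

Lemma msemigroup_comp (s t : word X -> word X) :
  msemigroup A s -> msemigroup A t -> msemigroup A (s \o t).
Proof. by move=> Ss St B cB; apply: (proj1 cB); [apply: Ss cB | apply: St cB]. Qed.

Lemma msemigroup_mact (q : mstate A) : msemigroup A (mact q).
Proof. by move=> B [_]; apply; exists q. Qed.

Lemma mlength_mprod (qs : seq (mstate A)) : msemigroup A (mprod qs) -> mlength A (mprod qs) <= size qs.
Proof. by move=> /mlengthP[_]; apply; exists qs. Qed.

End Products.

(** * The semigroup generated by f0 and f1 *)

Section Transformations.
Variables (m : nat) (m_gt1 : 1 < m).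

Local Notation f0 := (mact (Jf0 : mstate (J m))).
Local Notation f1 := (mact (Jf1 : mstate (J m))).
Local Notation S := (msemigroup (J m)).
Local Notation len := (mlength (J m)).

Lemma last_letter_subproof : m.-1 < m.
Proof. by case: m m_gt1. Qed.

Definition letter0 : 'I_m := Ordinal (ltnW m_gt1).
Definition last_letter : 'I_m := Ordinal last_letter_subproof.

Lemma last_letter_eq (i : 'I_m) : i.+1 = m -> i = last_letter.
Proof. by move=> im; apply: val_inj; apply: (congr1 predn im). Qed.

Lemma f0_first w : f0 (wcons letter0 w) = wcons letter0 w.
Proof.
rewrite Jf0_cons /= ltn_eqF //.
by congr wcons; apply: val_inj.
Qed.

Lemma f0_last w : f0 (wcons last_letter w) = wcons letter0 (f0 w).
Proof.
rewrite Jf0_cons /= (ltn_predK m_gt1) eqxx.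
by congr wcons; apply: val_inj.
Qed.

Lemma f1_last w : f1 (wcons last_letter w) = wcons letter0 (f1 w).
Proof.
rewrite Jf1_cons /= (ltn_predK m_gt1) eqxx.
by congr wcons; apply: val_inj => /=; rewrite (ltn_predK m_gt1) modnn.
Qed.

Lemma f1_step (i j : 'I_m) w : i.+1 = j -> f1 (wcons i w) = wcons j w.
Proof.
move=> ij; have jm := ltn_ord j.
rewrite Jf1_cons ij ltn_eqF //; congr wcons.
by apply: val_inj; rewrite /= ij modn_small.
Qed.

Lemma f0_step (i : 'I_m) w : i.+1 < m -> f0 (wcons i w) = wcons letter0 w.
Proof.
move=> im; rewrite Jf0_cons ltn_eqF //; congr wcons; exact: val_inj.
Qed.

Lemma f0_range w : exists v, f0 w = wcons letter0 v.
Proof.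
rewrite -[w]wcons_eta Jf0_cons; eexists; congr wcons; exact: val_inj.
Qed.

Lemma f0_idem w : f0 (f0 w) = f0 w.
Proof. by have [v ->] := f0_range w; apply: f0_first. Qed.

(** The inverse of the odometer [f1] is the odometer that subtracts one: its
    state says whether a borrow is still pending. *)
Definition Jpred : mealy 'I_m :=
  Mealy (fun (b : bool) i => b && (i == letter0))
        (fun (b : bool) i => if b then ord_pred i else i).

Lemma ordS_last (i : 'I_m) : (i.+1 == m) = (ordS i == letter0).
Proof.
rewrite -val_eqE /=; have := ltn_ord i; rewrite leq_eqVlt.
case: eqP => [->|_ /= lt]; first by rewrite modnn.
by rewrite modn_small.
Qed.

Lemma f1_pred w : f1 (mact (true : mstate Jpred) w) = w.
Proof.
set v := mact _ w.
(* The carry of f1 along v is the borrow made in computing v from w. *)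
have E n : mrun (Jf1 : mstate (J m)) v n =
    if mrun (true : mstate Jpred) w n then Jf1 else Je.
  elim: n => //= n ->; rewrite /Jtrans ordS_last /v /mact.
  by case: (mrun _ w n); rewrite ?if_same // -[mout _ _]/(ord_pred _) ord_predK.
apply/funext => n; rewrite /mact E /v /mact /=.
by case: (mrun _ w n) => //=; rewrite ord_predK.
Qed.

Lemma comp_f1_inj (s t : word 'I_m -> word 'I_m) : s \o f1 = t \o f1 -> s = t.
Proof.
move=> E; apply/funext => w; rewrite -[w]f1_pred.
exact: (congr1 (fun f => f _) E).
Qed.

(** A product of generators maintains the pair of a first letter [j] and a
    product [rs] acting on the rest.  Each generator either leaves [rs]
    alone and raises [j] by at most one, or, when [j] is the last letter, resets [j] to 0
    and prepends itself to [rs]: in both cases [j + m * size rs] grows by at most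
    one.  This bound gives the lower bounds on lengths. *)
Lemma mprod_letter0 (qs : seq (mstate (J m))) :
  exists (j : 'I_m) (rs : seq (mstate (J m))), j + m * size rs <= size qs /\
    forall w, mprod qs (wcons letter0 w) = wcons j (mprod rs w).
Proof.
elim: qs => [|q qs [j [rs [le_qs E]]]].
  by exists letter0, [::]; rewrite muln0.
case: q; first by exists j, rs; split=> [|w]; rewrite ?leqW //= E Je_id.
all: have := ltn_ord j; rewrite leq_eqVlt => /predU1P[jm|jm].
- exists letter0, (Jf0 :: rs); split=> [|w /=].
    have : j.+1 + m * size rs <= (size qs).+1 by []; rewrite {1}jm -mulnS.
    exact.
  by rewrite E (last_letter_eq jm) f0_last.
- exists letter0, rs; split=> [|w /=]; last by rewrite E f0_step.
  by apply: leqW; apply: leq_trans le_qs; apply: leq_addl.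
- exists letter0, (Jf1 :: rs); split=> [|w /=].
    have : j.+1 + m * size rs <= (size qs).+1 by []; rewrite {1}jm -mulnS.
    exact.
  by rewrite E (last_letter_eq jm) f1_last.
- by exists (Ordinal jm), rs; split=> [|w /=]; rewrite ?E ?(@f1_step _ (Ordinal jm)).
Qed.

Lemma mprod_nseq_f1 (j : 'I_m) w :
  mprod (nseq j (Jf1 : mstate (J m))) (wcons letter0 w) = wcons j w.
Proof.
case: j => j; elim: j => [|j IH] jm /=.
  by congr wcons; apply: val_inj.
by rewrite (IH (ltnW jm)); apply: f1_step.
Qed.

(** Converse of [mprod_letter0]: [m - 1] applications of [f1] carry the letter 0
    to the last letter, where one more generator [q] acts on the rest as [q]. *)
Lemma mprod_lift (j : 'I_m) (rs : seq (mstate (J m))) :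
  exists qs : seq (mstate (J m)), size qs <= j + m * size rs /\
    forall w, mprod qs (wcons letter0 w) = wcons j (mprod rs w).
Proof.
pose up := nseq m.-1 (Jf1 : mstate (J m)).
have upE w : mprod up (wcons letter0 w) = wcons last_letter w.
  exact: (mprod_nseq_f1 last_letter).
(* The final letter j is reached by j further applications of f1. *)
suff [qs [le_qs E]] : exists qs : seq (mstate (J m)), size qs <= m * size rs /\
    forall w, mprod qs (wcons letter0 w) = wcons letter0 (mprod rs w).
  exists (nseq j (Jf1 : mstate (J m)) ++ qs); split=> [|w].
    by rewrite size_cat size_nseq leq_add2l.
  by rewrite mprod_cat /= E mprod_nseq_f1.
elim: rs => [|q rs [qs [le_qs E]]]; first by exists [::].
have le_up : size up + size qs < m * (size rs).+1.
  by rewrite size_nseq -addSn (ltn_predK m_gt1) mulnS leq_add2l.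
case: q.
- exists qs; split=> [|w /=]; last by rewrite E Je_id.
  by apply: leq_trans le_qs _; rewrite leq_mul2l leqnSn orbT.
- exists (Jf0 :: up ++ qs); split=> [|w /=]; first by rewrite /= size_cat.
  by rewrite mprod_cat /= E upE f0_last.
- exists (Jf1 :: up ++ qs); split=> [|w /=]; first by rewrite /= size_cat.
  by rewrite mprod_cat /= E upE f1_last.
Qed.

(** On words [(m-1) w] the map [s f1] acts as [j (s' f1)(w)], where [s'] is the
    product that [s] induces below the letter 0.  If [s f1] is unchanged by [f0]
    then so is [s' f1], and [s'] is a shorter product than [s] because each of
    its factors costs [m > 1] factors of [s]. *)
Lemma comp_f1_not_f0_invariant (qs : seq (mstate (J m))) :
  mprod qs \o f1 \o f0 <> mprod qs \o f1.
Proof.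
have [n] := ubnP (size qs); elim: n qs => // n IH qs szqs /= E.
have {}E w : mprod qs (f1 (f0 w)) = mprod qs (f1 w) by apply: (congr1 (fun f => f w) E).
case: qs => [|q qs'] in szqs E *.
  (* Here f1 f0 = f1 fails on words starting with m - 1: the images start with
     1 and with 0. *)
  have := E (wcons last_letter (fun=> letter0)).
  rewrite /= f0_last f1_last (@f1_step _ (Ordinal m_gt1)) //.
  by move=> /(congr1 (fun w => val (w 0))).
have [j [rs [le_rs Ers]]] := mprod_letter0 (q :: qs').
set Q := mprod _ in E Ers.
have lt_rs : size rs < size (q :: qs').
  case: (posnP (size rs)) => [->//|rs_gt0].
  by apply: leq_trans (leq_trans (leq_addl j _) le_rs); apply: ltn_Pmull.
apply: (IH rs); first exact: leq_trans lt_rs _.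
apply/funext => w /=.
have Qlast v : Q (f1 (wcons letter0 (f0 v))) = wcons j (mprod rs (f1 v)).
  by rewrite -f0_last E f1_last Ers.
by apply: (proj2 (wcons_inj (etrans (esym (Qlast _)) _))); rewrite f0_idem Qlast.
Qed.

(** The last factor that is not the state [e] is applied first. *)
Lemma mprod_last (qs : seq (mstate (J m))) :
  [\/ mprod qs = id,
      exists2 rs : seq (mstate (J m)), size rs < size qs & mprod qs = mprod rs \o f1
    | exists2 rs : seq (mstate (J m)), size rs < size qs & mprod qs = mprod rs \o f0].
Proof.
elim/last_ind: qs => [|qs q IH]; first exact: Or31.
have E : mprod (rcons qs q) = mprod qs \o mact q by rewrite -cats1 mprod_cat.
rewrite E size_rcons; case: q E => _; last 2 first.
- by apply: Or33; exists qs.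
- by apply: Or32; exists qs.
have -> : mprod qs \o mact (Je : mstate (J m)) = mprod qs by rewrite Je_id.
case: IH => [->|[rs lt ->]|[rs lt ->]]; first exact: Or31.
- by apply: Or32; exists rs; rewrite // ltnW.
- by apply: Or33; exists rs; rewrite // ltnW.
Qed.

Lemma msemigroup_mprod (qs : seq (mstate (J m))) : S (mprod qs).
Proof.
elim: qs => [|q qs IH]; first by rewrite /= -(Je_id m); apply: msemigroup_mact.
by apply: msemigroup_comp => //; apply: msemigroup_mact.
Qed.

(** These are the elements of the form [s f0]: after [f0] the first letter is 0,
    and [s] turns [0w] into [j u(w)]. *)
Definition graft (j : 'I_m) (u : word 'I_m -> word 'I_m) : word 'I_m -> word 'I_m :=
  fun w => wcons j (u (wtail (f0 w))).

Lemma graft_f0 j u : graft j u \o f0 = graft j u.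
Proof. by apply/funext => w; rewrite /graft /= f0_idem. Qed.

Lemma graft_letter0 j u w : graft j u (wcons letter0 w) = wcons j (u w).
Proof. by rewrite /graft f0_first wconsK. Qed.

Lemma graft_inj j : injective (graft j).
Proof.
move=> u v E; apply/funext => w; rewrite -(wconsK j (u w)) -(wconsK j (v w)).
by rewrite -!graft_letter0 E.
Qed.

Lemma graft_mprod j (qs rs : seq (mstate (J m))) :
    (forall w, mprod qs (wcons letter0 w) = wcons j (mprod rs w)) ->
  mprod qs \o f0 = graft j (mprod rs).
Proof.
move=> E; apply/funext => w /=; rewrite /graft.
by have [v ->] := f0_range w; rewrite wconsK E.
Qed.

Lemma msemigroup_graft j u : S u -> S (graft j u).
Proof.
move=> /msemigroup_mproduct[l [rs _ ->]].
have [qs [_ /graft_mprod<-]] := mprod_lift j rs.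
exact: msemigroup_comp (msemigroup_mprod _) (msemigroup_mact _).
Qed.

(** A shortest product for [s f1] ends with [f1], since [s f1] is not unchanged by
    [f0]; as [f1] is surjective, it can be cancelled. *)
Lemma mlength_comp_f1 s : S s -> len (s \o f1) = (len s).+1.
Proof.
move=> Ss; have Ssf : S (s \o f1).
  exact: msemigroup_comp Ss (msemigroup_mact _).
have [[rs szrs Es] _] := mlengthP Ss.
have [[qs szqs Eqs] min_sf] := mlengthP Ssf.
apply/eqP; rewrite eqn_leq; apply/andP; split.
  apply: min_sf; exists (rcons rs Jf1); first by rewrite size_rcons szrs.
  by rewrite -cats1 mprod_cat Es.
rewrite -szqs; case: (mprod_last qs) => [E|[ts lt E]|[ts lt E]].
- (* If s f1 = id then f0 s f1 = f0, which is unchanged by f0. *)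
  case: (@comp_f1_not_f0_invariant (Jf0 :: rs)).
  have sf1 w : mprod rs (f1 w) = w.
    by rewrite -Es -[s (f1 w)]/((s \o f1) w) Eqs E.
  by apply/funext => w /=; rewrite !sf1 f0_idem.
- apply: leq_ltn_trans lt; rewrite E in Eqs.
  by rewrite (comp_f1_inj Eqs); apply: mlength_mprod (msemigroup_mprod _).
- case: (@comp_f1_not_f0_invariant rs); rewrite -Es Eqs E.
  by apply/funext => w /=; rewrite f0_idem.
Qed.

(** A shortest product for [graft j u] ends with [f0], because [graft j u] is
    unchanged by [f0]; what precedes maps [0w] to [j u(w)], which takes at least
    [j + m * len u] factors. *)
Lemma mlength_graft j u : S u -> len (graft j u) = (j + m * len u).+1.
Proof.
move=> Su; have Sg := msemigroup_graft j Su.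
have [[rs szrs Eu] min_u] := mlengthP Su.
have [[qs szqs Eqs] min_g] := mlengthP Sg.
apply/eqP; rewrite eqn_leq; apply/andP; split.
  have [ts [le_ts /graft_mprod Ets]] := mprod_lift j rs.
  rewrite -szrs; apply: leq_trans (_ : (size ts).+1 <= _); last by rewrite ltnS.
  apply: min_g; exists (rcons ts Jf0); first by rewrite size_rcons.
  by rewrite Eu -Ets -cats1 mprod_cat.
rewrite -szqs; case: (mprod_last qs) => [E|[ts lt E]|[ts lt E]].
- case: (@comp_f1_not_f0_invariant [::]); have := graft_f0 j u.
  rewrite Eqs E => f0id; apply/funext => w /=; congr (f1 _).
  by apply: (congr1 (fun f => f w) f0id).
- by case: (@comp_f1_not_f0_invariant ts); rewrite -E -Eqs graft_f0.
- apply: leq_ltn_trans lt; rewrite E in Eqs.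
  have [i [us [le_us Eus]]] := mprod_letter0 ts.
  have Ew w : wcons j (u w) = wcons i (mprod us w).
    by rewrite -graft_letter0 Eqs /= f0_first Eus.
  have [-> _] := wcons_inj (Ew (fun=> letter0)).
  apply: leq_trans le_us; rewrite leq_add2l leq_mul2l; apply/orP; right.
  apply: min_u; exists us => //; apply/funext => w.
  by have [_ ->] := wcons_inj (Ew w).
Qed.

Local Open Scope classical_set_scope.

Definition letter_mod n : 'I_m := Ordinal (ltn_pmod n (ltnW m_gt1)).

Lemma msphere_succ n :
  msphere (J m) n.+1 =
    (fun s => s \o f1) @` msphere (J m) n `|`
    graft (letter_mod n) @` msphere (J m) (n %/ m).
Proof.
apply/seteqP; split=> s.
  move=> [Ss szs]; have [[qs szqs Eqs] _] := mlengthP Ss.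
  case: (mprod_last qs) => [E|[ts lt E]|[ts lt E]].
  - by move: szs; rewrite Eqs E mlength_id.
  - left; exists (mprod ts); rewrite -?E //; split; first exact: msemigroup_mprod.
    apply: succn_inj; rewrite -mlength_comp_f1 -?E -?Eqs //.
    exact: msemigroup_mprod.
  - right; have [j [rs [_ /graft_mprod Ej]]] := mprod_letter0 ts.
    have Srs := msemigroup_mprod rs; rewrite Ej -Eqs in E.
    have := mlength_graft j Srs; rewrite -E szs => -[nE].
    exists (mprod rs).
      by split=> //; rewrite nE addnC mulnC divnMDl ?divn_small ?addn0 // ltnW.
    rewrite E; congr graft; apply: val_inj => /=.
    by rewrite nE addnC mulnC modnMDl modn_small.
move=> [[t [St szt] <-]|[u [Su szu] <-]].
  split; last by rewrite mlength_comp_f1 ?szt.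
  exact: msemigroup_comp St (msemigroup_mact _).
split; first exact: msemigroup_graft.
by rewrite mlength_graft // szu /= addnC mulnC -divn_eq.
Qed.

Lemma mgrowth0 : mgrowth (J m) 0 = 1.
Proof.
have E : msphere (J m) 0 = [set id].
  apply/seteqP; split=> [s [Ss szs]|_ ->].
    by have [+ _] := mlengthP Ss; rewrite szs => -[[|//] _ ->].
  by split; [apply: (msemigroup_mprod [::]) | apply: mlength_id].
by rewrite /mgrowth E fset_set1 cardfs1.
Qed.

Lemma mgrowth_succ n :
  mgrowth (J m) n.+1 = mgrowth (J m) n + mgrowth (J m) (n %/ m).
Proof.
have fin k := finite_msphere k (finite_Jstate m).
rewrite /mgrowth msphere_succ fset_setU; try exact: finite_image.
rewrite !fset_set_image //.
(* The union is disjoint: grafts are unchanged by f0. *)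
rewrite cardfsU (_ : (_ `&` _)%fset = fset0) ?cardfs0 ?subn0; last first.
  apply/fsetP => g; rewrite !inE; apply/negP => /andP[].
  move=> /imfsetP[/= s]; rewrite in_fset_set // inE => -[Ss _] ->.
  move=> /imfsetP[/= u _ E].
  have [l [qs _ Eqs]] := msemigroup_mproduct Ss.
  by case: (@comp_f1_not_f0_invariant qs); rewrite -Eqs E graft_f0.
rewrite !card_imfset //=; first exact: graft_inj.
exact: comp_f1_inj.
Qed.

End Transformations.

(** * Expansion of the functional equation *)

Section Series.
Local Open Scope ring_scope.
Variable R : comUnitRingType.
Implicit Types f g : fps R.

Lemma coefsD f g n : coefs (f + g) n = coefs f n + coefs g n.
Proof. by []. Qed.

Lemma coefsB f g n : coefs (f - g) n = coefs f n - coefs g n.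
Proof. by []. Qed.

Lemma coefs1 n : coefs (1 : fps R) n = (n == 0%N)%:R.
Proof. by []. Qed.

Lemma coefs_XM f n : coefs (fpsX * f) n = if n is k.+1 then coefs f k else 0.
Proof.
rewrite -[LHS]/(\sum_(j < n.+1) (j == 1%N :> nat)%:R * coefs f (n - j)%N).
case: n => [|n]; first by rewrite big_ord1 mul0r.
rewrite 2!big_ord_recl /= mul0r add0r mul1r subn1 big1 ?addr0 // => i _.
by rewrite mul0r.
Qed.

Lemma coefs_XnM d f n :
  coefs (fpsX ^+ d * f) n = if (n < d)%N then 0 else coefs f (n - d)%N.
Proof.
elim: d n => [|d IH] n; first by rewrite expr0 mul1r subn0.
by rewrite exprS -mulrA coefs_XM; case: n => // n; rewrite IH.
Qed.

Lemma subXn_unit d : (0 < d)%N -> (1 - fpsX ^+ d : fps R) \is a GRing.unit.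
Proof.
move=> d_gt0; rewrite -[_ \is a _]/(coefs (1 - fpsX ^+ d) 0%N \is a GRing.unit).
by rewrite coefsB -[fpsX ^+ d]mulr1 coefs_XnM d_gt0 subr0 coefs1 unitr1.
Qed.

(** The substitution of [X^d] for [X], when [d > 0]. *)
Definition dilate d f : fps R :=
  Fps (fun n => if (d %| n)%N then coefs f (n %/ d)%N else 0).

Lemma coefs_dilate d f n :
  coefs (dilate d f) n = if (d %| n)%N then coefs f (n %/ d)%N else 0.
Proof. by []. Qed.

Lemma dilateD d f g : dilate d (f + g) = dilate d f + dilate d g.
Proof.
by apply: fpsP => n; rewrite coefsD /=; case: ifP => // _; rewrite addr0.
Qed.

Lemma dilateB d f g : dilate d (f - g) = dilate d f - dilate d g.
Proof.
by apply: fpsP => n; rewrite coefsB /=; case: ifP => // _; rewrite subr0.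
Qed.

Lemma dilate1 d : (0 < d)%N -> dilate d 1 = 1.
Proof.
move=> d_gt0; apply: fpsP => n; rewrite coefs_dilate !coefs1.
case: ifP => [/dvdnP[k ->]|nd]; last by case: eqP nd => // ->; rewrite dvdn0.
by rewrite mulnK // muln_eq0 (gtn_eqF d_gt0) orbF.
Qed.

Lemma dilateXM d f : (0 < d)%N -> dilate d (fpsX * f) = fpsX ^+ d * dilate d f.
Proof.
move=> d_gt0; apply: fpsP => n; rewrite coefs_XnM !coefs_dilate.
case: ltnP => [nd|dn].
  by rewrite divn_small // coefs_XM if_same.
rewrite -{1 2}(subnK dn) dvdn_addl // divnDr // divnn d_gt0 addn1 coefs_XM.
by [].
Qed.

Lemma dilateX d : (0 < d)%N -> dilate d fpsX = fpsX ^+ d.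
Proof. by move=> d_gt0; rewrite -[fpsX]mulr1 dilateXM ?dilate1 ?mulr1. Qed.

Lemma dilate_dilate d e f : (0 < d)%N -> (0 < e)%N ->
  dilate d (dilate e f) = dilate (d * e) f.
Proof.
move=> d_gt0 e_gt0; apply: fpsP => n /=; rewrite divnMA.
case: (boolP (d %| n)%N) => [/dvdnP[k ->]|nd].
  by rewrite mulnK // [(k * d)%N]mulnC dvdn_pmul2l.
by case: ifP => // /(dvdn_trans (dvdn_mulr e (dvdnn d))); rewrite (negbTE nd).
Qed.

Section Functional.
(** The hypothesis [A_eq] is [A(X) = 1 + X / (1 - X) A(X^m)] with its denominator
    cleared, so that it can be checked coefficient by coefficient. *)
Variables (m : nat) (A : fps R).
Hypothesis m_gt0 : (0 < m)%N.
Hypothesis A_eq : (1 - fpsX) * A = (1 - fpsX) + fpsX * dilate m A.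

Let ratio i : fps R := fpsX ^+ (m ^ i) / (1 - fpsX ^+ (m ^ i)).
Let term k := \prod_(i < k.+1) ratio i.

Lemma dilate_functional k :
  dilate (m ^ k) A = 1 + ratio k * dilate (m ^ k.+1) A.
Proof.
have d_gt0 : (0 < m ^ k)%N by rewrite expn_gt0 m_gt0.
have U := subXn_unit d_gt0.
have := congr1 (dilate (m ^ k)) A_eq.
rewrite mulrBl mul1r dilateB dilateD dilateB !dilateXM //.
rewrite dilateX // dilate1 //.
rewrite dilate_dilate // -expnSr -[X in X - _ = _]mul1r -mulrBl => E.
apply: (mulrI U); rewrite E mulrDr mulr1; congr (_ + _).
by rewrite mulrA [ratio k]mulrC mulrA divrr // mul1r.
Qed.

Lemma term_succ k : term k.+1 = term k * ratio k.+1.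
Proof. by rewrite /term big_ord_recr. Qed.

(** The nested expression cut off at depth [k], with its exact remainder. *)
Lemma dilate_expansion k :
  A - 1 = \sum_(i < k) term i + term k * dilate (m ^ k.+1) A.
Proof.
have A1 : dilate (m ^ 0) A = A.
  by apply: fpsP => n; rewrite /= dvd1n divn1.
elim: k => [|k IH].
  by rewrite big_ord0 add0r /term big_ord1 -{1}A1 dilate_functional addrC addKr.
rewrite IH big_ord_recr /= -addrA; congr (_ + _).
by rewrite dilate_functional mulrDr mulr1 mulrA -[in LHS]term_succ.
Qed.

(** Each of the [k + 1] factors is divisible by [X]. *)
Lemma term_order k : exists g, term k = fpsX ^+ k.+1 * g.
Proof.
exists (\prod_(i < k.+1) (fpsX ^+ (m ^ i).-1 / (1 - fpsX ^+ (m ^ i)))).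
have -> : fpsX ^+ k.+1 = \prod_(i < k.+1) fpsX :> fps R.
  by rewrite prodr_const card_ord.
rewrite -big_split /=; apply: eq_bigr => i _.
by rewrite mulrA -exprS prednK // expn_gt0 m_gt0.
Qed.

Lemma functional_has_sum : fps_has_sum term (A - 1).
Proof.
move=> n; exists n => k nk; rewrite (dilate_expansion k) coefsD.
have [g ->] := term_order k.
by rewrite -mulrA coefs_XnM ltnS nk addr0.
Qed.

End Functional.
(** Multiplication by [1 - X] takes differences of consecutive coefficients, so
    the recurrence turns into [coefs A n.+1 = coefs D (n %/ m)].  As
    [(n.+1) %/ m] exceeds [n %/ m] exactly when [m] divides [n.+1], taking
    differences once more leaves only the exponents divisible by [m]. *)
Lemma growth_functional m D (A := (1 - fpsX) * D) :
    (0 < m)%N -> coefs D 0 = 1 ->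
    (forall n, coefs D n.+1 = coefs D n + coefs D (n %/ m)%N) ->
  (1 - fpsX) * A = (1 - fpsX) + fpsX * dilate m A.
Proof.
move=> m_gt0 d0 dS.
have a0 : coefs A 0 = 1.
  by rewrite /A mulrBl mul1r coefsB coefs_XM subr0.
have aS n : coefs A n.+1 = coefs D (n %/ m)%N.
  by rewrite /A mulrBl mul1r coefsB coefs_XM dS addrAC subrr add0r.
apply: fpsP => n; rewrite mulrBl mul1r coefsB coefsD coefsB !coefs_XM.
rewrite -[coefs fpsX n]/((n == 1%N)%:R).
case: n => [|n]; first by rewrite coefs1 a0 addr0.
rewrite -[LHS]/(coefs A n.+1 - coefs A n).
rewrite -[RHS]/(0 - (n == 0%N)%:R + coefs (dilate m A) n).
rewrite sub0r coefs_dilate aS; case: n => [|n].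
  by rewrite dvdn0 !div0n a0 d0 subrr addNr.
rewrite oppr0 add0r aS; case: ifP => mn; rewrite divnS // mn.
  by rewrite add1n aS dS addrAC subrr add0r.
by rewrite add0n subrr.
Qed.

End Series.

Local Open Scope ring_scope.

Theorem corollary2p4 (m : nat) (hm : (2 <= m)%N) :
  exists2 T : fps int,
    fps_has_sum
      (fun k => \prod_(i < k.+1) (fpsX ^+ (m ^ i) / (1 - fpsX ^+ (m ^ i)))) T
    & mgrowth_series (J m) = 1 / (1 - fpsX) * (1 + T).
Proof.
exists ((1 - fpsX) * mgrowth_series (J m) - 1).
  apply: functional_has_sum; first exact: ltnW.
  apply: growth_functional; first exact: ltnW.
    by rewrite -[LHS]/(Posz (mgrowth (J m) 0)) mgrowth0.
  move=> n; rewrite -[LHS]/(Posz (mgrowth (J m) n.+1)).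
  by rewrite (mgrowth_succ hm) PoszD.
by rewrite [1 + (_ * _ - 1)]addrC subrK mulrA mul1r mulVr ?mul1r.
Qed.
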